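(* If $G$ is a connected graph (finite or infinite) endowed with the path metric, then $$\wp(G)\notin\left(\log_2(2+\sqrt{3}),\,2\right).$$
   Context: Graphs are simple and undirected. The path metric on a connected graph is the metric on its vertex set in which the distance between two vertices is the number of edges in a shortest path joining them. For $p\ge 0$, a metric space $(X,d)$ has $p$-negative type if for all natural numbers $k\ge 2$, all finite subsets $\{x_1,\dots,x_k\}\subset X$ and all real numbers $\alpha_1,\dots,\alpha_k$ with $\alpha_1+\cdots+\alpha_k=0$ one has $\sum_{1\le i,j\le k} d(x_i,x_j)^p\alpha_i\alpha_j\le 0$ (with the convention $d(x,x)^0=0$ when $p=0$). The supremal $p$-negative type of $(X,d)$ is $\wp(X)=\wp(X,d)=\sup\{p\ge 0 : (X,d)\text{ has }p\text{-negative type}\}\in[0,\infty]$; for a graph $G$ with the path metric, $\wp(G)$ is that of its vertex set with this metric. The interval in the claim is the open interval. *)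

(* Defs.v *)
From HB Require Import structures.
From mathcomp Require Export all_boot all_order all_algebra.
From mathcomp Require Export all_classical all_reals all_analysis.

Set Implicit Arguments.
Unset Strict Implicit.
Unset Printing Implicit Defensive.

Import Order.TTheory GRing.Theory Num.Theory.

Local Open Scope ring_scope.
Local Open Scope classical_set_scope.

(* A graph is given by its adjacency relation [e : rel V]; it is simple and
   undirected when [e] is symmetric and irreflexive, and the vertex set [V] may
   be infinite. *)

(* The sequence [s] lists the vertices after [x], so the path from [x] to [y]
   has [size s] edges. *)
Definition is_path (V : eqType) (e : rel V) (x y : V) (s : seq V) : Prop :=
  [/\ uniq (x :: s), path e x s & last x s = y].

Definition connected_graph (V : eqType) (e : rel V) : Prop :=
  forall x y : V, exists s : seq V, is_path e x y s.

Definition path_lengths (V : eqType) (e : rel V) (x y : V) : set nat :=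
  [set n | exists2 s : seq V, is_path e x y s & size s = n].

(* The value 0 is a default, used only if no path joins [x] and [y]. *)
Definition graph_dist (V : eqType) (e : rel V) (x y : V) : nat :=
  xget 0%N [set n | path_lengths e x y n /\
                    forall m, path_lengths e x y m -> (n <= m)%N].

Definition path_metric (R : realType) (V : eqType) (e : rel V) (x y : V) : R :=
  (graph_dist e x y)%:R.

(* [powR 0 0 = 1], whereas the convention here is that [d(x, x) ^ 0 = 0]. *)
Definition dist_pow (R : realType) (r p : R) : R :=
  if (r == 0) && (p == 0) then 0 else powR r p.

Definition negative_type (R : realType) (X : Type) (d : X -> X -> R) (p : R) :
    Prop :=
  forall (k : nat) (x : 'I_k -> X) (a : 'I_k -> R),
    (2 <= k)%N -> injective x -> \sum_i a i = 0 ->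
    \sum_i \sum_j dist_pow (d (x i) (x j)) p * a i * a j <= 0.

Definition supremal_negative_type (R : realType) (X : Type) (d : X -> X -> R) :
    \bar R :=
  ereal_sup [set p%:E | p in [set p : R | 0 <= p /\ negative_type d p]].

Definition log2 (R : realType) (x : R) : R := ln x / ln 2.

(* Main.v *)
(* Write t = 2 ^ p.  If the path metric has p-negative type for some p with
   t > 2 + sqrt 3, then G has no induced claw or diamond (these force t <= 3) and
   no induced paw (with weights t - 2 on the pendant vertex, -t on its neighbour
   and 1, 1 on the other two vertices it forces (t - 2) ^ 2 <= 3), so the centre
   of an induced path on three vertices has degree two.  Nor does it have an
   isometric cycle of length at least 4: alternating weights +-1 on two opposite
   edges give n ^ p <= (n - 1) ^ p + 2 with n >= 2, while convexity yields
   n ^ p - (n - 1) ^ p >= t - 1 > 2.  If G contains a triangle, the first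
   restriction makes it complete; otherwise the second makes every edge a bridge
   and the first makes G a path, which embeds in the line.  In both cases G has
   2-negative type, so the supremum is at least 2. *)
Require Import Defs.
From mathcomp Require Import all_boot all_order all_algebra.
From mathcomp Require Import all_classical all_reals all_analysis.
From mathcomp Require Import zify ring lra.

Set Implicit Arguments.
Unset Strict Implicit.
Unset Printing Implicit Defensive.

Import Order.TTheory GRing.Theory Num.Theory.

Local Open Scope ring_scope.

(** * Real powers and criteria for negative type *)

Section RealFacts.
Context {R : realType}.

Lemma powR2_gt (p c : R) : 0 < c -> log2 c < p -> c < powR 2 p.
Proof.
move=> c0; have l2 : (0 : R) < ln 2 by rewrite ln_gt0// ltr1n.
rewrite /log2 ltr_pdivrMr// -ln_powR ltr_ln// posrE// powR_gt0//.
Qed.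

(* 2 and n + 1 lie between 1 and n + 2 and have the same sum. *)
Lemma powR_succ_convex (p : R) (n : nat) : 1 <= p ->
  powR 2 p + powR n.+1%:R p <= 1 + powR n.+2%:R p.
Proof.
move=> p1; have n0 : (0 : R) < n.+1%:R by rewrite ltr0n.
have t0 : (0 : R) <= n.+1%:R^-1 by rewrite invr_ge0 ltW.
have t1 : (n.+1%:R^-1 : R) <= 1 by rewrite invf_le1// ler1n.
have cvx (x y : R) : 0 <= x -> 0 <= y ->
    powR (n.+1%:R^-1 * x + (1 - n.+1%:R^-1) * y) p
    <= n.+1%:R^-1 * powR x p + (1 - n.+1%:R^-1) * powR y p.
  move=> x0 y0; apply: (convex_powR p1 (Itv01 t0 t1));
    by rewrite inE/= in_itv/= andbT.
(* With weight 1/(n+1) on one endpoint and the rest on the other, the two convex combinations of 1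
   and n + 2 are 2 and n + 1. *)
have := cvx 1 n.+2%:R ler01 (ler0n _ _); have := cvx n.+2%:R 1 (ler0n _ _) ler01.
rewrite powR1.
have -> : n.+1%:R^-1 * n.+2%:R + (1 - n.+1%:R^-1) * 1 = 2 :> R.
  by rewrite -[n.+2%:R]natr1; field; rewrite gt_eqF.
have -> : n.+1%:R^-1 * 1 + (1 - n.+1%:R^-1) * n.+2%:R = n.+1%:R :> R.
  by rewrite -[n.+2%:R]natr1; field; rewrite gt_eqF.
by move: n.+1%:R^-1 (powR _ p) (powR 2 p) (powR n.+1%:R p) => t A B C; lra.
Qed.

Lemma negative_type4 (X : eqType) (d : X -> X -> R) (p : R) (x y z w : X)
    (a b c g : R) :
  (forall x y, d x y = d y x) -> (forall x, d x x = 0) -> p != 0 ->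
  negative_type d p -> uniq [:: x; y; z; w] -> a + b + c + g = 0 ->
  powR (d x y) p * a * b + powR (d x z) p * a * c + powR (d x w) p * a * g
  + powR (d y z) p * b * c + powR (d y w) p * b * g + powR (d z w) p * c * g
  <= 0.
Proof.
move=> dC d0 p0 neg uq s0.
pose t := [tuple x; y; z; w]; pose u := [tuple a; b; c; g].
have /tuple_uniqP inj : uniq t by [].
have := neg 4 (tnth t) (tnth u) isT inj.
rewrite !big_ord_recl !big_ord0 !(tnth_nth x) !(tnth_nth a)/= /dist_pow.
rewrite (negbTE p0) !andbF !d0 powR0//.
rewrite (dC y x) (dC z x) (dC w x) (dC z y) (dC w y) (dC w z).
by move=> /(_ ltac:(lra)); lra.
Qed.

(** Expanding the squares, every term with a factor [\sum_i a i] vanishes and only the cross term,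
    minus twice a square, survives. *)
Lemma line_negative_type2 (X : Type) (d : X -> X -> R) (f : X -> R) :
  (forall x y, 0 <= d x y) -> (forall x y, d x y ^+ 2 = (f x - f y) ^+ 2) ->
  negative_type d 2.
Proof.
move=> d0 df k x a _ _ s0.
have dE i j : dist_pow (d (x i) (x j)) 2 = (f (x i) - f (x j)) ^+ 2.
  by rewrite /dist_pow pnatr_eq0 andbF powR_mulrn.
set S := \sum_i a i * f (x i).
set Q := \sum_i a i * f (x i) ^+ 2.
suff -> : \sum_i \sum_j dist_pow (d (x i) (x j)) 2 * a i * a j = - 2 * S ^+ 2.
  by have := sqr_ge0 S; lra.
transitivity (\sum_i (a i * f (x i) ^+ 2 * (\sum_j a j)
    + (- 2 * (a i * f (x i))) * S + a i * Q)).
  apply: eq_bigr => i _; rewrite !mulr_sumr -!big_split /=.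
  by apply: eq_bigr => j _; rewrite dE; ring.
by rewrite !big_split /= -!mulr_suml -mulr_sumr s0 -/S; ring.
Qed.

Lemma discrete_negative_type2 (X : eqType) (d : X -> X -> R) :
  (forall x y, d x y = (x != y)%:R) -> negative_type d 2.
Proof.
move=> dE k x a _ inj s0.
suff -> : \sum_i \sum_j dist_pow (d (x i) (x j)) 2 * a i * a j
    = - \sum_i a i ^+ 2.
  by rewrite oppr_le0 sumr_ge0// => i _; exact: sqr_ge0.
rewrite -sumrN; apply: eq_bigr => i _.
transitivity (a i * (\sum_j a j) - a i ^+ 2); last by rewrite s0; ring.
rewrite [in RHS](bigD1 i)//= (bigD1 i)//= dE eqxx /dist_pow eqxx pnatr_eq0/=.
rewrite powR0 ?pnatr_eq0// !mul0r add0r mulrDr expr2 addrC addKr mulr_sumr.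
apply: eq_bigr => j ji; rewrite dE (inj_eq inj) (eq_sym i) ji oner_eq0/= powR1.
by rewrite mul1r.
Qed.

End RealFacts.

(** * The path metric of a connected graph *)

Section GraphDist.
Context {V : eqType} {e : rel V}.
Hypotheses (e_sym : symmetric e) (e_irr : irreflexive e).
Hypothesis e_conn : connected_graph e.

Local Notation d := (graph_dist e).

Lemma graph_distP x y :
  path_lengths e x y (d x y) /\
  forall m, path_lengths e x y m -> (d x y <= m)%N.
Proof.
have [s sP] := e_conn x y.
have ex : exists n, `[< path_lengths e x y n >].
  by exists (size s); apply/asboolP; exists s.
suff : exists n, path_lengths e x y n /\
    forall m, path_lengths e x y m -> (n <= m)%N by move/(xgetPex 0%N).
case: (ex_minnP ex) => m /asboolP mP min; exists m; split=> // n nP.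
by apply: min; apply/asboolP.
Qed.

Lemma graph_dist_walk x y :
  exists s, [/\ path e x s, last x s = y & size s = d x y].
Proof. by have [[s [_ ? ?] ?] _] := graph_distP x y; exists s. Qed.

(** Vertices of [s] may repeat here: any walk shortens to a path, and walks, unlike paths, can be
    concatenated freely. *)
Lemma graph_dist_le x s : path e x s -> (d x (last x s) <= size s)%N.
Proof.
move=> /shortenP[s' ps' us' ss'].
have le : (size s' <= size s)%N by case/andP: us' => _ us'; exact: uniq_leq_size.
apply: leq_trans le; have [_ ] := graph_distP x (last x s'); apply.
by exists s'.
Qed.

Lemma graph_distxx x : d x x = 0%N.
Proof. by apply/eqP; rewrite -leqn0; apply: (@graph_dist_le x [::]). Qed.

Lemma graph_dist_eq0 x y : (d x y == 0%N) = (x == y).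
Proof.
apply/eqP/eqP => [d0|->]; last exact: graph_distxx.
by have [s [_ sy]] := graph_dist_walk x y; rewrite d0 => /size0nil s0; rewrite -sy s0.
Qed.

Lemma graph_dist_edge x y : (d x y == 1%N) = e x y.
Proof.
apply/eqP/idP => [d1|exy].
  have [s [ps sy ss]] := graph_dist_walk x y; rewrite -sy.
  by rewrite d1 in ss; case: s ss ps {sy} => [|z [|? ?]]//= _ /andP[].
apply/eqP; rewrite eqn_leq lt0n graph_dist_eq0.
rewrite (@graph_dist_le x [:: y]) ?andbT/= ?exy//.
by apply: contraTneq exy => ->; rewrite e_irr.
Qed.

Lemma graph_dist_triangle y x z : (d x z <= d x y + d y z)%N.
Proof.
have [s [ps <- <-]] := graph_dist_walk x y.
have [r [pr <- <-]] := graph_dist_walk (last x s) z.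
by rewrite -last_cat -size_cat graph_dist_le// cat_path ps.
Qed.

Lemma graph_dist_succ x y n : d x y = n.+1 -> exists2 z, e z y & d x z = n.
Proof.
have [s [ps ls ss]] := graph_dist_walk x y => dn.
case/lastP: s => [|s w] in ps ls ss *; first by rewrite dn in ss.
move: ps ls ss; rewrite rcons_path last_rcons size_rcons dn.
move=> /andP[ps eyw] wy ss.
rewrite -{}wy in dn *; case: ss => ss; exists (last x s) => //.
have := graph_dist_triangle (last x s) x w.
have /eqP -> : d (last x s) w == 1%N by rewrite graph_dist_edge.
by have := graph_dist_le ps; lia.
Qed.

Lemma graph_distC x y : d x y = d y x.
Proof.
suff le a b : (d a b <= d b a)%N by apply/eqP; rewrite eqn_leq !le.
move: {2}(d b a) (leqnn (d b a)) => n; elim: n a b => [|n IH] a b.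
  by rewrite leqn0 graph_dist_eq0 => /eqP ->; rewrite graph_distxx.
rewrite leq_eqVlt => /predU1P[dn|]; last by rewrite ltnS => /IH.
have [z eza dz] := graph_dist_succ dn.
have := graph_dist_triangle z a b; have := IH z b; rewrite dz => /(_ (leqnn _)).
have -> : d a z = 1%N by apply/eqP; rewrite graph_dist_edge e_sym.
by rewrite dn; lia.
Qed.

Lemma graph_dist_nonadj x y z :
  e y x -> e y z -> x != z -> ~~ e x z -> d x z = 2%N.
Proof.
move=> eyx eyz; rewrite -graph_dist_eq0 -graph_dist_edge.
have := graph_dist_triangle y x z.
have /eqP -> : d x y == 1%N by rewrite graph_dist_edge e_sym.
have /eqP -> : d y z == 1%N by rewrite graph_dist_edge.
by lia.
Qed.

Lemma graph_dist_between x y k : (k <= d x y)%N ->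
  exists2 z, d x z = k & (d x z + d z y)%N = d x y.
Proof.
move: {2}(d x y - k)%N (erefl (d x y - k)%N) => n.
elim: n y => [|n IH] y dn kd.
  by exists y; rewrite ?graph_distxx ?addn0//; lia.
have [w ewy dw] := @graph_dist_succ x y (d x y).-1 ltac:(lia).
have [||z dz dzw] := IH w; [lia..|exists z => //].
have := graph_dist_triangle w z y; have := graph_dist_triangle z x y.
have /eqP -> : d w y == 1%N by rewrite graph_dist_edge.
by lia.
Qed.

(* [no_branch] excludes the induced claw, paw and diamond (K4 minus an edge).
   The quadrilaterals excluded by [no_quad] are those formed by two opposite edges
   [uv] and [xy] of an isometric cycle, with [d u x = m + 1] for the cycle of
   length [2 m + 4] and [d u x = m + 2] for the cycle of length [2 m + 5]. *)
Definition no_branch : Prop := forall y x z w,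
  uniq [:: y; x; z; w] -> e y x -> e y z -> e y w -> e x z.

Definition no_quad : Prop := forall u v x y m,
  e u v -> e x y -> d u y = m.+2 -> d v x = m.+2 -> d v y = m.+1 ->
  (m.+2 < d u x)%N.

Lemma complete_of_triangle u v w : no_branch -> e u v -> e v w -> e u w ->
  forall x y, x != y -> e x y.
Proof.
move=> nb euv evw euw.
have neq x y : e x y -> x != y by apply: contraTneq => ->; rewrite e_irr.
(* Let [y] be the middle vertex of a shortest path from [u] to [x]. If [y] is [v] or [w], the
   triangle gives [y] a third neighbour; otherwise [no_branch] at [u] gives [e y v]. Then
   [no_branch] at [y] yields [e u x]. *)
have far x : d u x != 2%N.
  apply/eqP => dx; have [y eyx dy] := graph_dist_succ dx.
  have euy : e u y by rewrite -graph_dist_edge dy.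
  have eux : ~~ e u x by rewrite -graph_dist_edge dx.
  have ux : u != x by rewrite -graph_dist_eq0 dx.
  have main t s : e u t -> e u s -> e t s -> y = t -> False.
    move=> eut eus ets yt; rewrite yt in eyx.
    have xs : x != s by apply: contraNneq eux => ->.
    case/negP: eux; apply: (nb t u x s) => //; last by rewrite e_sym.
    rewrite /= !inE !negb_or (eq_sym t u) (neq u t eut) (neq t x eyx) (neq t s ets).
    by rewrite ux (neq u s eus) xs.
  have yv : y != v by apply/eqP => /(main v w); exact.
  have yw : y != w by apply/eqP => /(main w v); apply => //; rewrite e_sym.
  have eyv : e y v.
    apply: (nb u y v w) => //; rewrite /= !inE !negb_or (neq u y euy) (neq u v euv).
    by rewrite (neq u w euw) yv yw neq.
  have xv : x != v by apply: contraNneq eux => ->.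
  case/negP: eux; apply: (nb y u x v) => //; first 1 last.
    by rewrite e_sym.
  rewrite /= !inE !negb_or (eq_sym y u) (neq u y euy) (neq y x eyx) yv.
  by rewrite ux (neq u v euv) xv.
have near x : x != u -> e u x.
  move=> xu; rewrite -graph_dist_edge.
  have d0 : d u x != 0%N by rewrite graph_dist_eq0 eq_sym.
  case: (leqP 2 (d u x)) => [/graph_dist_between[z /eqP dz _]|]; last lia.
  by rewrite (negbTE (far z)) in dz.
move=> x y xy; have [xu|xu] := eqVneq x u.
  by rewrite xu in xy *; rewrite near// eq_sym.
have [->|yu] := eqVneq y u; first by rewrite e_sym near.
(* Now [u] is adjacent to all other vertices, so a third neighbour [t] suffices; [v] or [w] serves
   unless [x] and [y] are these two. *)
have main t : e u t -> t != x -> t != y -> e x y.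
  move=> eut tx ty; apply: (nb u x y t) => //; [|exact: near..].
  by rewrite /= !inE !negb_or xy (eq_sym u x) xu (eq_sym u y) yu
    (neq u t eut) (eq_sym x) tx (eq_sym y) ty.
have [vx|vx] := eqVneq v x.
  have [wy|wy] := eqVneq w y; first by rewrite -vx -wy.
  by apply: (main w) => //; rewrite -vx eq_sym neq.
have [vy|vy] := eqVneq v y; last exact: (main v).
have [wx|wx] := eqVneq w x; first by rewrite -vy -wx e_sym.
by apply: (main w) => //; rewrite -vy eq_sym neq.
Qed.

(** * Triangle-free graphs as subsets of the line *)

Section TriangleFree.
Hypothesis triangle_free : forall u v w, e u v -> e v w -> e u w -> False.
Hypotheses (nb : no_branch) (nq : no_quad).

(** A vertex equidistant from [u] and [v] would close an odd cycle: at distance 1 a triangle, and at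
    a minimal larger distance a configuration excluded by [no_quad]. *)
Lemma edge_dist u v x : e u v ->
  [/\ (d u x <= d v x + 1)%N, (d v x <= d u x + 1)%N & d u x <> d v x].
Proof.
move=> euv; have duv : d u v = 1%N by apply/eqP; rewrite graph_dist_edge.
have le y : (d u y <= d v y + 1)%N /\ (d v y <= d u y + 1)%N.
  have := graph_dist_triangle v u y; have := graph_dist_triangle u v y.
  by rewrite (graph_distC v u) duv; lia.
suff neq n : forall y, d u y = n -> d v y = n -> False.
  by have [? ?] := le x; split=> // E; exact: (neq (d u x) x erefl (esym E)).
elim/ltn_ind: n => -[|[|n]] IH y duy dvy.
- move/eqP: duy; move/eqP: dvy; rewrite !graph_dist_eq0 => /eqP vy /eqP uy.
  by rewrite vy uy e_irr in euv.
- by apply: (triangle_free euv (w := y)); rewrite -graph_dist_edge ?duy ?dvy.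
- have [z ezy dvz] := graph_dist_succ dvy.
  have := graph_dist_triangle z u y.
  have -> : d z y = 1%N by apply/eqP; rewrite graph_dist_edge.
  have [lez _] := le z => tri.
  have [duz|duz] : d u z = n.+1 \/ d u z = n.+2 by lia.
    exact: (IH n.+1 _ z).
  have := @nq u v y z n euv; rewrite (e_sym y) duy ltnn.
  by move=> /(_ ezy duz dvy dvz).
Qed.

(* By [edge_dist] every vertex is strictly nearer to [u] or to [v], so [uv] is
   indeed a bridge. *)
Lemma bridge u v x y : e u v -> e x y -> (d u x < d v x)%N -> (d v y < d u y)%N ->
  x = u /\ y = v.
Proof.
move=> euv exy ux vy.
have [a1 a2 a3] := edge_dist x euv; have [b1 b2 b3] := edge_dist y euv.
have [] := edge_dist u exy; have [] := edge_dist v exy.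
rewrite !(graph_distC _ u) !(graph_distC _ v) => c1 c2 c3 c4 c5 c6.
have uxvy : d u x = d v y by lia.
case E : (d u x) => [|m].
  move/eqP: (E); move/eqP: (E); rewrite {1}uxvy !graph_dist_eq0.
  by move=> /eqP -> /eqP ->.
have := @nq u v x y m euv exy; rewrite E.
by move=> /(_ ltac:(lia) ltac:(lia) ltac:(lia)); lia.
Qed.

(** By induction [x] and [y] have the same predecessor [z] towards [v], and a branching at [z] would
    create a triangle. *)
Lemma side_unique u v x y : e u v -> (d v x < d u x)%N -> (d v y < d u y)%N ->
  d v x = d v y -> x = y.
Proof.
move=> euv; move: {2}(d v x) (erefl (d v x)) => n.
elim: n x y => [|n IH] x y dvx ux uy xy.
  have vx : v = x by apply/eqP; rewrite -graph_dist_eq0 dvx.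
  by rewrite -vx; apply/eqP; rewrite -graph_dist_eq0 -xy dvx.
have [z ezx dz] := graph_dist_succ dvx.
have [w ewy dw] := graph_dist_succ (etrans (esym xy) dvx).
have [zx1 zx2 _] := edge_dist u ezx; have [wy1 wy2 _] := edge_dist u ewy.
have [ux1 ux2 _] := edge_dist x euv; have [uy1 uy2 _] := edge_dist y euv.
have [uz1 uz2 _] := edge_dist z euv; have [uw1 uw2 _] := edge_dist w euv.
rewrite !(graph_distC _ u) in zx1 zx2 wy1 wy2.
have zw : z = w by apply: IH; lia.
rewrite -zw in ewy.
(* Stepping towards [u] rather than [v] provides [t] even when [z] is [v]; then [t] is [u]. *)
have [t etz dt] := @graph_dist_succ u z n ltac:(lia).
apply/eqP/negP => /negP nxy.
have neq a b : e a b -> a != b by apply: contraTneq => ->; rewrite e_irr.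
have tx : x != t by apply/eqP => E; rewrite E in ux ux1 dvx; lia.
have ty : y != t by apply/eqP => E; rewrite E in uy uy1 xy; lia.
have exy : e x y.
  apply: (@nb z x y t) => //; last by rewrite e_sym.
  by rewrite /= !inE !negb_or (neq z x) ?(neq z y) ?(neq z t) ?nxy ?tx ?ty// e_sym.
exact: (triangle_free ezx exy).
Qed.

(** By uniqueness, a shortest path from [v] to [y] passes through [x]. *)
Lemma side_dist u v x y : e u v -> (d v x < d u x)%N -> (d v y < d u y)%N ->
  (d v x <= d v y)%N -> d v y = (d v x + d x y)%N.
Proof.
move=> euv ux uy /graph_dist_between[z dz dzy].
suff -> : x = z by rewrite dzy.
apply: (side_unique euv) => //.
have := graph_dist_triangle z u y; lia.
Qed.

(** Follow a shortest path back from [y]: by [bridge], the only step that can change sides is the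
    edge [uv]. *)
Lemma cross_dist u v x y : e u v -> (d u x < d v x)%N -> (d v y < d u y)%N ->
  d x y = (d u x + d v y).+1.
Proof.
move=> euv ux; move: {2}(d x y) (erefl (d x y)) => n.
elim: n y => [|n IH] y dn vy.
  by move/eqP: dn vy; rewrite graph_dist_eq0 => /eqP <-; lia.
have [z ezy dz] := graph_dist_succ dn.
have := graph_dist_triangle u x y; have := graph_dist_triangle v u y.
have /eqP -> : d u v == 1%N by rewrite graph_dist_edge.
have [z1 z2 z3] := edge_dist z euv; have [y1 y2 _] := edge_dist v ezy.
rewrite (graph_distC x u); rewrite !(graph_distC _ v) in y1 y2.
case: (ltnP (d v z) (d u z)) => uz; first by have := IH z dz uz; lia.
have [zu yv] := @bridge u v z y euv ezy ltac:(lia) vy.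
by rewrite yv zu graph_distxx graph_distC in dn dz *; lia.
Qed.

(** The origin is [u], and [v] has coordinate 1; vertices on the side of [u] go to the left. *)
Definition line_coord {R : realType} u v x : R :=
  if (d u x < d v x)%N then - (d u x)%:R else (d u x)%:R.

Lemma line_coordP {R : realType} u v x y : e u v ->
  path_metric R e x y ^+ 2 = (line_coord u v x - line_coord u v y) ^+ 2.
Proof.
move=> euv; have evu : e v u by rewrite e_sym.
have [x1 x2 x3] := edge_dist x euv; have [y1 y2 y3] := edge_dist y euv.
rewrite /line_coord /path_metric.
case: (ltnP (d u x) (d v x)) => ux; case: (ltnP (d u y) (d v y)) => uy.
- have [le|le] := leqP (d u x) (d u y).
    by rewrite (side_dist evu ux uy le) natrD; ring.
  by rewrite (side_dist evu uy ux (ltnW le)) (graph_distC y) natrD; ring.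
- rewrite (cross_dist euv ux); last lia.
  have -> : d u y = (d v y).+1 by lia.
  by rewrite -addnS natrD; ring.
- rewrite graph_distC (cross_dist euv uy); last lia.
  have -> : d u x = (d v x).+1 by lia.
  by rewrite -addnS natrD; ring.
- have {}ux : (d v x < d u x)%N by lia.
  have {}uy : (d v y < d u y)%N by lia.
  have -> : d u x = (d v x).+1 by lia.
  have -> : d u y = (d v y).+1 by lia.
  have [le|le] := leqP (d v x) (d v y).
    by rewrite (side_dist euv ux uy le) -addSn natrD; ring.
  by rewrite (side_dist euv uy ux (ltnW le)) -addSn (graph_distC y) natrD; ring.
Qed.

End TriangleFree.

Lemma negative_type2_of_local {R : realType} : no_branch -> no_quad ->
  negative_type (path_metric R e) 2.
Proof.
move=> nb nq.
have complete : (forall x y, x != y -> e x y) -> negative_type (path_metric R e) 2.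
  move=> cmp; apply: discrete_negative_type2 => x y; rewrite /path_metric.
  have [->|/cmp] := eqVneq x y; first by rewrite graph_distxx.
  by rewrite -graph_dist_edge => /eqP ->.
have [[u [v [w [uv vw uw]]]]|tf] := pselect (exists u v w, [/\ e u v, e v w & e u w]).
  by apply: complete; exact: complete_of_triangle uv vw uw.
have [[u [v uv]]|no_edge] := pselect (exists u v, e u v).
  apply: (@line_negative_type2 _ _ _ (line_coord u v)) => x y.
    exact: ler0n.
  apply: line_coordP => // a b c ab bc ac; apply: tf.
  by exists a, b, c.
(* Without edges, connectedness leaves at most one vertex, so the graph is trivially complete. *)
apply: complete => x y xy; case dn : (d x y) => [|n].
  by move/eqP: dn; rewrite graph_dist_eq0 (negbTE xy).
by have [z ezy _] := graph_dist_succ dn; case: no_edge; exists z, y.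
Qed.

(** * Local conditions forced by a large exponent *)

Section LargeExponent.
Context {R : realType} {p : R}.
Hypothesis neg : negative_type (path_metric R e) p.
Hypothesis p_gt : log2 (2 + Num.sqrt 3) < p.

Let T := powR 2 p.

Lemma powR2_gt_sqrt3 : Num.sqrt 3 < T - 2.
Proof.
have := sqrtr_ge0 (3 : R) => s3.
by have := @powR2_gt R p _ _ p_gt; rewrite -/T; lra.
Qed.

Lemma powR2_gt3 : 3 < T.
Proof.
have : Num.sqrt 3 ^+ 2 = 3 :> R by rewrite sqr_sqrtr.
by have := powR2_gt_sqrt3; have := sqrtr_ge0 (3 : R); nra.
Qed.

Lemma exponent_ge1 : 1 <= p.
Proof.
have [//|p1] := leP 1 p.
have /(ler_powR (ler1n R 2)) : p <= 1 by exact: ltW.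
by rewrite powRr1 -/T//; have := powR2_gt3; lra.
Qed.

Lemma path_negative_type4 x y z w (a b c g : R) :
  uniq [:: x; y; z; w] -> a + b + c + g = 0 ->
  powR (d x y)%:R p * a * b + powR (d x z)%:R p * a * c
  + powR (d x w)%:R p * a * g + powR (d y z)%:R p * b * c
  + powR (d y w)%:R p * b * g + powR (d z w)%:R p * c * g <= 0.
Proof.
apply: (negative_type4 (d := path_metric R e)) => //.
- by move=> *; rewrite /path_metric graph_distC.
- by move=> *; rewrite /path_metric graph_distxx.
- by have := exponent_ge1; lra.
Qed.

Lemma negative_type_no_quad : no_quad.
Proof.
move=> u v x y m; rewrite -!graph_dist_edge => /eqP uv /eqP xy uy vx vy.
rewrite ltnNge; apply/negP => ux.
have neq a b n : d a b = n.+1 -> a != b by rewrite -graph_dist_eq0 => ->.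
have uq : uniq [:: u; v; x; y].
  rewrite /= !inE !negb_or (neq _ _ _ uv) (neq _ _ _ uy) (neq _ _ _ vx).
  rewrite (neq _ _ _ vy) (neq _ _ _ xy) !andbT /=.
  by apply/eqP => E; rewrite E xy in uy.
(* These weights give [2 (m+2)^p <= 2 + (d u x)^p + (m+1)^p]. *)
have := @path_negative_type4 u v x y 1 (-1) (-1) 1 uq ltac:(lra).
have := powR_succ_convex m exponent_ge1; rewrite -/T.
have p0 : 0 <= p by have := exponent_ge1; lra.
have : powR (d u x)%:R p <= powR m.+2%:R p.
  by apply: ge0_ler_powR; rewrite ?nnegrE ?ler0n ?ler_nat.
by rewrite uv xy uy vx vy !powR1; have := powR2_gt3; lra.
Qed.

Lemma negative_type_no_branch : no_branch.
Proof.
move=> y x z w uq eyx eyz eyw; apply/negP => /negP exz.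
have T3 := powR2_gt3.
have sq : 3 < (T - 2) ^+ 2.
  have : Num.sqrt 3 ^+ 2 = 3 :> R by rewrite sqr_sqrtr.
  by have := powR2_gt_sqrt3; have := sqrtr_ge0 (3 : R); nra.
have d1 a b : e a b -> powR (d a b)%:R p = 1.
  by rewrite -graph_dist_edge => /eqP ->; rewrite powR1.
have d2 a b : e y a -> e y b -> a != b -> ~~ e a b -> powR (d a b)%:R p = T.
  by move=> ya yb ab nab; rewrite (graph_dist_nonadj ya yb).
have := uq; rewrite /= !inE !negb_or => /and4P[/and3P[yx yz yw] /andP[xz xw] zw _].
have ineq a b c g := @path_negative_type4 y x z w a b c g uq.
rewrite (d1 _ _ eyx) (d1 _ _ eyz) (d1 _ _ eyw) (d2 _ _ eyx eyz xz exz) in ineq.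
case: (boolP (e x w)) => exw; case: (boolP (e z w)) => ezw.
(* The cases are the diamond, the paw with pendant vertex [z], the paw with pendant vertex [x], and
   the claw. The left-hand sides are [T - 3], [(T - 2)^2 - 3] twice, and [3 T - 9], all positive. *)
- have := ineq (-1) 1 1 (-1) ltac:(lra); rewrite !d1//; lra.
- have := ineq (- (T - 2) - 2) 1 (T - 2) 1 ltac:(lra).
  by rewrite (d1 _ _ exw) (d2 _ _ eyz eyw)//; nra.
- have := ineq (- (T - 2) - 2) (T - 2) 1 1 ltac:(lra).
  by rewrite (d1 _ _ ezw) (d2 _ _ eyx eyw)//; nra.
- have := ineq (- 3) 1 1 1 ltac:(lra).
  by rewrite (d2 _ _ eyx eyw) ?(d2 _ _ eyz eyw)//; lra.
Qed.

End LargeExponent.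

End GraphDist.

Theorem theorem3p2 (R : realType) (V : eqType) (e : rel V)
    (e_sym : symmetric e) (e_irr : irreflexive e) (e_conn : connected_graph e) :
  supremal_negative_type (path_metric R e)
    \notin `](log2 (2 + Num.sqrt 3 : R))%:E, 2%:E[.
Proof.
rewrite in_itv /= negb_and -!leNgt.
have [neg2|not2] := pselect (negative_type (path_metric R e) 2).
  by rewrite (ereal_sup_ubound (x := 2%:E)) ?orbT//; exists 2.
(* If 2-negative type fails, no admissible exponent exceeds the lower endpoint, as such an exponent
   would imply 2-negative type. *)
rewrite ge_ereal_sup// => _ [p [_ neg] <-]; rewrite lee_fin leNgt.
apply/negP => p_gt; apply: not2.
apply: negative_type2_of_local => //.
  exact: negative_type_no_branch neg p_gt.
exact: negative_type_no_quad neg p_gt.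
Qed.
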